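(* Let $\mathcal{C}$ be a polyhedral complex in $\mathbb{R}^d$ and $f\in\overline{\mathcal{V}}_{\mathcal{C}}$. Suppose there are $g,h\in\overline{\mathcal{V}}_{\mathcal{C}}^{+}$ such that $f=g-h$, $\operatorname{supp}_{\mathcal{C}}^{+}(f)=\operatorname{supp}_{\mathcal{C}}(g)$ and $\operatorname{supp}_{\mathcal{C}}^{-}(f)=\operatorname{supp}_{\mathcal{C}}(h)$. Then $(g,h)$ is the unique vertex of $\mathcal{D}_{\mathcal{Q}}(f)$ for every regular complete polyhedral complex $\mathcal{Q}$ compatible with $f$. In this case, $g$ and $h$ each have at most as many pieces as $f$.
   Context: A polyhedral complex $\mathcal{C}$ in $\mathbb{R}^d$ is a finite collection of polyhedra containing $\emptyset$, closed under taking faces, such that any two members intersect in a common face; $\mathcal{C}^k$ denotes its $k$-dimensional members. All polyhedral complexes are assumed pure of dimension $d$ and complete (the union of the members is $\mathbb{R}^d$). A function $f\colon\mathbb{R}^d\to\mathbb{R}$ is CPWL if there is such a complex $\mathcal{C}$ with $f$ affine on every member of $\mathcal{C}$; then $f$ and $\mathcal{C}$ are called compatible. The number of pieces of $f$ is the smallest possible value of $\#\mathcal{C}^d$ over all compatible complexes. For a convex CPWL function $f=\max_{i\in[k]}(\langle a_i,x\rangle+b_i)$ (with the $\langle a_i,x\rangle +b_i$ its distinct affine components on full-dimensional regions), $\mathcal{C}_f$ is the unique coarsest compatible complex, with regions $\{x\mid\langle a_i,x\rangle+b_i=f(x)\}$; a complex is regular if it equals $\mathcal{C}_f$ for some convex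 CPWL function $f$. $\mathcal{V}_{\mathcal{C}}$ is the (finite-dimensional) vector space of CPWL functions compatible with $\mathcal{C}$, $\overline{\mathcal{V}}_{\mathcal{C}}=\mathcal{V}_{\mathcal{C}}/\mathrm{Aff}(\mathbb{R}^d)$ its quotient by affine functions, and $\overline{\mathcal{V}}_{\mathcal{C}}^{+}$ the cone of classes of convex functions. $\mathcal{D}_{\mathcal{Q}}(f)=\{(g,h)\mid g,h\in\overline{\mathcal{V}}_{\mathcal{Q}}^{+},\ f=g-h\}$ (equality modulo affine functions), a polyhedron in $\overline{\mathcal{V}}_{\mathcal{Q}}\times\overline{\mathcal{V}}_{\mathcal{Q}}$. For $\sigma\in\mathcal{C}^{d-1}$ with $\sigma=P\cap Q$, $P,Q\in\mathcal{C}^d$, let $e_{P/\sigma}$ be the unit vector orthogonal to $\operatorname{aff}(\sigma)$ pointing from $\sigma$ into $P$, and let $a_P,a_Q$ be the gradients of $f$ on $P$ and $Q$. The weight function of $f\in\mathcal{V}_{\mathcal{C}}$ is $w_f(\sigma)=\langle e_{P/\sigma},a_P-a_Q\rangle$; it depends only on the class of $f$ modulo affine functions. Set $\operatorname{supp}_{\mathcal{C}}(f)=\{\sigma\in\mathcal{C}^{d-1}\mid w_f(\sigma)\neq0\}$, $\operatorname{supp}^{+}_{\mathcal{C}}(f)=\{\sigma\in\mathcal{C}^{d-1}\mid w_f(\sigma)>0\}$, $\operatorname{supp}^{-}_{\mathcal{C}}(f)=\{\sigma\in\mathcal{C}^{d-1}\mid w_f(\sigma)<0\}$. *)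

(* Defs.v *)
From HB Require Import structures.
From mathcomp Require Import all_boot all_order all_algebra.
From mathcomp Require Import generic_quotient ring_quotient.
From mathcomp Require Import all_classical all_reals convex.

Set Implicit Arguments.
Unset Strict Implicit.
Unset Printing Implicit Defensive.

Import Order.TTheory GRing.Theory Num.Theory.

Local Open Scope classical_set_scope.
Local Open Scope ring_scope.
Local Open Scope quotient_scope.

Section Polyhedra.
Context {R : realType} {E : lmodType R}.
Implicit Types P F : set E.

Definition polyhedron P :=
  exists n (L : 'I_n -> {scalar E}) (b : 'I_n -> R),
    P = [set x | forall i, L i x <= b i].

(* [L = 0] yields the improper faces: [P] for [b = 0] and [set0] for [b = 1]. *)
Definition face P F :=
  exists (L : {scalar E}) (b : R),
    (forall x, P x -> L x <= b) /\ F = P `&` [set x | L x = b].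

(* zero-dimensional faces *)
Definition vertices P : set E := [set z | face P [set z]].

Definition affine_hull P : set E :=
  [set x | exists n (l : 'I_n -> R) (y : 'I_n -> E),
    [/\ forall i, P (y i), \sum_i l i = 1 & x = \sum_i l i *: y i]].

End Polyhedra.

Section Complexes.
Context {R : realType} {d : nat}.
Notation V := 'rV[R]_d.
Implicit Types (P S : set V) (C Q : set (set V)) (f : V -> R^o).

Definition dot (u v : V) : R := \sum_i u 0 i * v 0 i.

(* False for [P = set0], whose dimension is -1. *)
Definition has_dim P (k : nat) :=
  exists (x : V) (M : 'M[R]_(k, d)),
    row_free M /\ affine_hull P = [set x + u *m M | u in setT].

Definition cells C (k : nat) : set (set V) := [set P | C P /\ has_dim P k].

(* The members of dimension d - 1; there are none when d = 0. *)
Definition walls C : set (set V) :=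
  [set S | exists2 k : nat, k.+1 = d & cells C k S].

(* Purity and completeness are standing assumptions, hence included. *)
Definition polyhedral_complex C :=
  [/\ finite_set C,
      (forall P, C P -> polyhedron P),
      C set0,
      (forall P F, C P -> face P F -> C F) &
      (forall P P', C P -> C P' -> face P (P `&` P') /\ face P' (P `&` P'))] /\
  [/\ (forall P, C P -> exists2 P', cells C d P' & P `<=` P') &
      \bigcup_(P in C) P = setT].

Definition affine_on P f :=
  exists (a : V) (b : R), forall x, P x -> f x = dot a x + b.

Definition compatible C : set (V -> R) :=
  [set f | forall P, C P -> affine_on P f].

Definition convex_fun f := convex_function (E := V) setT f.

(* The default value 0 is only taken when f is not CPWL. *)
Definition num_pieces f : nat :=
  let N := [set n | exists C, [/\ polyhedral_complex C, compatible C f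
                               & (cells C d #= `I_n)%card]] in
  xget 0%N [set n | N n /\ forall m, N m -> (n <= m)%N].

Definition refines C Q := forall P, C P -> exists2 P', Q P' & P `<=` P'.

(* Q is the complex C_f of the convex CPWL function f.  The last clause, which
   follows from the others when f is convex, records the regions of C_f. *)
Definition coarsest_complex f Q :=
  [/\ polyhedral_complex Q,
      compatible Q f,
      (forall C, polyhedral_complex C -> compatible C f -> refines C Q) &
      exists k (a : 'I_k -> V) (b : 'I_k -> R),
        let region i := [set x | dot (a i) x + b i = f x] in
        [/\ injective (fun i => (a i, b i)),
            (forall x, (exists i, f x = dot (a i) x + b i) /\
                       forall i, dot (a i) x + b i <= f x),
            (forall i, has_dim (region i) d) &
            cells Q d = range region]].

Definition regular Q := exists2 f, convex_fun f & coarsest_complex f Q.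

Definition unit_normal P S (e : V) :=
  [/\ dot e e = 1,
      (forall x y, affine_hull S x -> affine_hull S y -> dot e (x - y) = 0) &
      exists x (t : R), [/\ S x, 0 < t & P (x + t *: e)]].

Definition gradient P f (a : V) :=
  exists b : R, forall x, P x -> f x = dot a x + b.

Definition is_weight C f S (w : R) :=
  exists P P' e a a',
    [/\ cells C d P, cells C d P' & S = P `&` P'] /\
    [/\ unit_normal P S e, gradient P f a, gradient P' f a'
      & w = dot e (a - a')].

(* [is_weight C f S] is a singleton when [f] is compatible with the complex
   [C] and [S] is one of its walls; it does not depend on the order of the two
   cells, as swapping them changes the sign of [e] too. *)
Definition weight C f S : R := xget 0 [set w | is_weight C f S w].

Definition is_affine f := affine_on setT f.

Definition affine_pred : {pred V -> R^o} := [pred f | `[< is_affine f >]].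

Lemma dot_comb (k : R) (a b x : V) :
  dot (k *: a + b) x = k * dot a x + dot b x.
Proof.
rewrite /dot mulr_sumr -big_split /=; apply: eq_bigr => i _.
by rewrite !mxE mulrDl mulrA.
Qed.

Lemma affine_pred_comb (k : R) (f g : V -> R^o) :
  f \in affine_pred -> g \in affine_pred -> k *: f + g \in affine_pred.
Proof.
move=> /asboolP[a [b fE]] /asboolP[a' [b' gE]].
apply/asboolP; exists (k *: a + a'), (k * b + b') => x _.
change (k * f x + g x = dot (k *: a + a') x + (k * b + b')).
by rewrite fE// gE// dot_comb mulrDr addrACA.
Qed.

Lemma affine_pred0 : 0 \in affine_pred.
Proof.
apply/asboolP; exists 0, 0 => x _.
by rewrite /dot big1 ?addr0// => i _; rewrite mxE mul0r.
Qed.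

Lemma affine_pred_zmod_closed : zmod_closed affine_pred.
Proof.
split=> [|f g fA gA]; first exact: affine_pred0.
by rewrite addrC -scaleN1r; exact: affine_pred_comb.
Qed.

HB.instance Definition _ :=
  GRing.isZmodClosed.Build (V -> R^o) affine_pred affine_pred_zmod_closed.

End Complexes.

(* Real functions on R^d modulo affine functions.  The quotient spaces of the
   spaces [compatible C] are all subspaces of this one. *)
Definition modAff (R : realType) (d : nat) : Type :=
  Quotient.quot (@affine_pred R d : zmodClosed _).

Section ModAff.
Context {R : realType} {d : nat}.
Notation V := 'rV[R]_d.
Notation Fbar := (modAff R d).

HB.instance Definition _ := GRing.Zmodule.on Fbar.

Definition cls (f : V -> R^o) : Fbar :=
  \pi_(Quotient.quot (@affine_pred R d : zmodClosed _)) f.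

Definition rep (u : Fbar) : V -> R^o :=
  repr (u : Quotient.quot (@affine_pred R d : zmodClosed _)).

Lemma repK : cancel rep cls.
Proof. exact: reprK. Qed.

Lemma clsP (f g : V -> R^o) : cls f = cls g <-> is_affine (f - g).
Proof.
have e := Quotient.idealrBE (@affine_pred R d : zmodClosed _) f g.
split=> [/eqP fg|/asboolP fg]; first by apply/asboolP; rewrite -e in fg.
by apply/eqP; move: fg; rewrite -[`[< _ >]]/(f - g \in affine_pred) e.
Qed.

Lemma clsD (f g : V -> R^o) : cls (f + g) = cls f + cls g.
Proof. exact: (raddfD (\pi_(Quotient.quot (@affine_pred R d : zmodClosed _)))). Qed.

Definition modAff_scale (k : R) (u : Fbar) : Fbar := cls (k *: rep u).

Lemma clsZ (k : R) (f : V -> R^o) : modAff_scale k (cls f) = cls (k *: f).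
Proof.
apply/clsP; rewrite -scalerBr -[_ *: _]addr0; apply/asboolP.
apply: affine_pred_comb; last exact: affine_pred0.
by apply/asboolP/clsP; rewrite repK.
Qed.

Lemma modAff_scaleA (a b : R) (u : Fbar) :
  modAff_scale a (modAff_scale b u) = modAff_scale (a * b) u.
Proof. by rewrite -(repK u) [modAff_scale b _]clsZ !clsZ scalerA. Qed.

Lemma modAff_scale1 : left_id 1 modAff_scale.
Proof. by move=> u; rewrite -(repK u) clsZ scale1r. Qed.

Lemma modAff_scaleDr : right_distributive modAff_scale +%R.
Proof.
move=> a u v; rewrite -(repK u) -(repK v).
by rewrite -clsD !clsZ scalerDr clsD.
Qed.

Lemma modAff_scaleDl (u : Fbar) : {morph modAff_scale^~ u : a b / a + b}.
Proof. by move=> a b; rewrite -(repK u) !clsZ scalerDl clsD. Qed.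

HB.instance Definition _ := GRing.Zmodule_isLmodule.Build R Fbar
  modAff_scaleA modAff_scale1 modAff_scaleDr modAff_scaleDl.

Implicit Types (C Q : set (set V)) (f g h : Fbar).

Definition compatible_cls C : set Fbar :=
  [set cls F | F in compatible C].

Definition convex_cls C : set Fbar :=
  [set cls F | F in compatible C `&` [set F | convex_fun F]].

(* The weight and the number of pieces only depend on the class modulo affine
   functions, so that they are read off an arbitrary representative. *)
Definition weight_cls C f : set V -> R := weight C (rep f).
Definition num_pieces_cls f : nat := num_pieces (rep f).

Definition supp C f : set (set V) :=
  [set S | walls C S /\ weight_cls C f S != 0].
Definition supp_pos C f : set (set V) :=
  [set S | walls C S /\ 0 < weight_cls C f S].
Definition supp_neg C f : set (set V) :=
  [set S | walls C S /\ weight_cls C f S < 0].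

(* A polyhedron in compatible_cls Q x compatible_cls Q; its faces do not depend
   on the ambient space, as linear forms on a subspace extend. *)
Definition decompositions Q f : set (Fbar * Fbar) :=
  [set gh | [/\ convex_cls Q gh.1, convex_cls Q gh.2 & f = gh.1 - gh.2]].

End ModAff.

(* Main.v *)
Require Import Defs.
From HB Require Import structures.
From mathcomp Require Import all_boot all_order all_algebra.
From mathcomp Require Import all_classical all_reals.
From mathcomp Require Import ring lra unstable.
From mathcomp Require Import topology normedtype derive convex.
From mathcomp Require Import interval_inference.
Import Order.TTheory GRing.Theory Num.Theory.
Import numFieldNormedType.Exports.
Local Open Scope classical_set_scope.
Local Open Scope ring_scope.

(** The supports of [g] and [h] are the sets of walls of [C] on which [f] has
    positive, respectively negative, weight, so that no wall belongs to both.  As a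
    function of weight 0 on a wall is affine near the relative interior points of
    that wall, at every point outside the cells of codimension at least 2 one of
    [g] and [h] is locally affine ([locally_affine_off_thin]).  This dichotomy has
    two consequences, for any complex [Q] compatible with [f].

    Where [f] is affine, both [g] and [h] are locally affine off the small cells.
    So [g] and [h] are affine on the cells of [Q], that is, they are compatible
    with [Q] ([summands_compatible]).  Every complex that is a candidate for
    counting the pieces of [f] is then one for [g] and [h], which gives the bounds
    on the numbers of pieces.

    If [f = g' - h'] is another decomposition into convex functions, then
    [v = g' - g = h' - h] is locally convex off the small cells: it differs from the
    convex [g'] by a locally affine function, or from the convex [h'] by one.  Hence
    [v] is convex ([convex_difference]).  The polyhedron of decompositions is
    therefore [(g, h)] plus the cone of the pairs [(v, v)] with [v] convex and
    compatible with [Q] ([decompositionP]).  Modulo affine functions this cone is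
    pointed, and its apex is its only vertex ([unique_vertex]); the linear form
    exposing the apex is built from finitely many Jensen gaps
    ([gaps_detect_affine]).

    Both consequences pass from local to global by [convex_local_to_global]: a
    segment can be moved slightly in a generic direction so as to avoid all the
    cells of codimension at least 2, and along the moved segment local convexity
    gives convexity. *)

Set Implicit Arguments.
Unset Strict Implicit.

(** * The scalar product and normal vectors *)

Section Dot.
Context {R : realType} {d : nat}.
Notation V := 'rV[R]_d.
Implicit Types (a b u v w x y z : V).

Lemma dotC u v : dot u v = dot v u.
Proof. by apply: eq_bigr => i _; rewrite mulrC. Qed.

Lemma dotDr a u v : dot a (u + v) = dot a u + dot a v.
Proof.
by rewrite /dot -big_split; apply: eq_bigr => i _; rewrite mxE mulrDr.
Qed.

Lemma dotZr a k u : dot a (k *: u) = k * dot a u.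
Proof. by rewrite /dot mulr_sumr; apply: eq_bigr => i _; rewrite mxE mulrCA. Qed.

Lemma dotNr a u : dot a (- u) = - dot a u.
Proof. by rewrite -scaleN1r dotZr mulN1r. Qed.

Lemma dotBr a u v : dot a (u - v) = dot a u - dot a v.
Proof. by rewrite dotDr dotNr. Qed.

Lemma dot0r a : dot a 0 = 0.
Proof. by rewrite -(scale0r 0) dotZr mul0r. Qed.

Lemma dotDl a b u : dot (a + b) u = dot a u + dot b u.
Proof. by rewrite dotC dotDr !(dotC u). Qed.

Lemma dotZl k a u : dot (k *: a) u = k * dot a u.
Proof. by rewrite dotC dotZr (dotC u). Qed.

Lemma dotBl a b u : dot (a - b) u = dot a u - dot b u.
Proof. by rewrite dotC dotBr !(dotC u). Qed.

Lemma dot0l u : dot 0 u = 0.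
Proof. by rewrite dotC dot0r. Qed.

Lemma dot_sumr a (I : finType) (F : I -> V) :
  dot a (\sum_i F i) = \sum_i dot a (F i).
Proof. by elim/big_rec2: _ => [|i u v _ <-]; rewrite (dot0r, dotDr). Qed.

Lemma dot_mx a u : (a *m u^T) 0 0 = dot a u.
Proof. by rewrite mxE; apply: eq_bigr => i _; rewrite mxE. Qed.

Lemma dot_ge0 a : 0 <= dot a a.
Proof. by apply: sumr_ge0 => i _; rewrite -expr2 sqr_ge0. Qed.

Lemma dot_eq0 a : dot a a = 0 -> a = 0.
Proof.
move=> /eqP; rewrite psumr_eq0 => [/allP a0|i _]; last by rewrite -expr2 sqr_ge0.
apply/rowP => i; have := a0 i (mem_index_enum _).
by rewrite mulf_eq0 orbb mxE => /eqP.
Qed.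

Lemma dot_gt0 a : a != 0 -> 0 < dot a a.
Proof. by rewrite lt_def dot_ge0 andbT; apply: contra_neq => /dot_eq0. Qed.

Lemma scalar_dot (L : {scalar V}) : exists a, forall x, L x = dot a x.
Proof.
exists (\row_j L (delta_mx 0 j)) => x.
rewrite {1}[x]row_sum_delta linear_sum; apply: eq_bigr => i _.
by rewrite linearZ/= mxE mulrC.
Qed.

Lemma dot_scalar a : exists L : {scalar V}, forall x, L x = dot a x.
Proof.
have Ll : linear_for *%R (dot a) by move=> k u v; rewrite dotDr dotZr.
pose lin := GRing.isLinear.Build R V R *%R (dot a) Ll.
pose L : {scalar V} := HB.pack (dot a) lin.
by exists L.
Qed.

Lemma polyhedron_dot (P : set V) : polyhedron P ->
  exists n (a : 'I_n -> V) (b : 'I_n -> R),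
    P = [set x | forall i, dot (a i) x <= b i].
Proof.
move=> [n [L [b ->]]]; have [a aE] := choice (fun i => scalar_dot (L i)).
exists n, a, b; apply/seteqP; split=> x Lx i; first by rewrite -aE.
by rewrite aE.
Qed.

Lemma affine_hull_dot (P : set V) a (b : R) :
  (forall x, P x -> dot a x = b) -> forall x, affine_hull P x -> dot a x = b.
Proof.
move=> Pb x [n [l [y [Py l1 ->]]]].
rewrite dot_sumr -[RHS]mul1r -l1 mulr_suml; apply: eq_bigr => i _.
by rewrite dotZr Pb.
Qed.

Lemma sub_affine_hull (P : set V) : P `<=` affine_hull P.
Proof.
move=> x Px; exists 1%N, (fun=> 1), (fun=> x).
by split=> //; rewrite big_ord1 ?scale1r.
Qed.

(** The left kernel of [M^T] is nonzero for dimension reasons. *)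
Lemma normal_exists k (M : 'M[R]_(k, d)) : (\rank M < d)%N ->
  exists2 a, a != 0 & forall u : 'rV_k, dot a (u *m M) = 0.
Proof.
move=> Md; have : kermx M^T != 0.
  by rewrite -mxrank_eq0 mxrank_ker mxrank_tr -lt0n subn_gt0.
case/rowV0Pn => a /sub_kermxP aM a0; exists a => // u.
by rewrite -dot_mx trmx_mul mulmxA aM mul0mx mxE.
Qed.

(** By dimension count, the row space of [M] fills the kernel of its normal. *)
Lemma hyperplane_normal k (M : 'M[R]_(k, d)) : row_free M -> k.+1 = d ->
  exists2 e, dot e e = 1 &
    forall v, dot e v = 0 <-> exists u : 'rV_k, v = u *m M.
Proof.
move=> Mf kd; have Mk : \rank M = k by apply/eqP.
have [|a a0 aM] := @normal_exists _ M; first by rewrite Mk -kd.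
have ap := dot_gt0 a0; set r := Num.sqrt (dot a a).
have r0 : r != 0 by rewrite gt_eqF// sqrtr_gt0.
exists (r^-1 *: a) => [|v].
  rewrite dotZl dotZr mulrA -(sqr_sqrtr (ltW ap)) -/r -expr2 -exprMn.
  by rewrite mulVf ?expr1n.
rewrite dotZl; split=> [/eqP|[u ->]]; last by rewrite aM mulr0.
rewrite mulf_eq0 invr_eq0 (negPf r0)/= => /eqP av.
have sub : (M <= kermx a^T)%MS.
  apply/sub_kermxP/matrixP => i j; rewrite ord1.
  by have := aM (delta_mx 0 i); rewrite -rowE dotC -dot_mx -row_mul !mxE.
have rk : \rank (kermx a^T) = k by rewrite mxrank_ker mxrank_tr rank_rV a0 -kd subn1.
have [_ eqk] := mxrank_leqif_sup sub.
have kM : (kermx a^T <= M)%MS by rewrite -eqk rk Mk.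
have vM : (v <= M)%MS.
  apply: submx_trans kM; apply/sub_kermxP/matrixP => i j.
  by rewrite !ord1 dot_mx dotC av mxE.
by have /submxP[u uE] := vM; exists u.
Qed.

End Dot.

(** * Affine functions of a small positive parameter *)

Section Near.
Context {R : realType}.

Lemma near_affine_lt (a b c : R) : a < c -> \forall t \near 0^'+, a + t * b < c.
Proof.
move=> ac; have [b0|b0] := leP b 0.
  near=> t; apply: le_lt_trans ac; rewrite gerDl mulr_ge0_le0//.
near=> t; rewrite -ltrBrDl -ltr_pdivlMr//.
by near: t; apply: nbhs_right_lt; rewrite divr_gt0// subr_gt0.
Unshelve. all: by end_near. Qed.

Lemma near_affine_le (a b c : R) :
  (\forall t \near 0^'+, a + t * b <= c) -> a <= c.
Proof.
move=> abc; rewrite leNgt; apply/negP => ca.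
have [|t] := filter_ex (filterI abc (@near_affine_lt (- a) (- b) (- c) _)).
  by rewrite ltrN2.
by move=> [h1]; rewrite mulrN -opprD ltrN2 ltNge h1.
Qed.

(** This dichotomy is what makes polyhedra tame along rays: a closed half-space,
    hence a polyhedron, either contains an initial open segment of a ray or
    misses one. *)
Lemma near_affine_dec (a b c : R) :
  (\forall t \near 0^'+, a + t * b <= c) \/ (\forall t \near 0^'+, c < a + t * b).
Proof.
have [ac|ca|->] := ltgtP a c.
- by left; near do apply: ltW; exact: near_affine_lt.
- right; have h : - a < - c by rewrite ltrN2.
  by near do rewrite -ltrN2 opprD -mulrN; exact: near_affine_lt.
have [b0|b0] := leP b 0; [left|right]; near=> t.
  by rewrite gerDl mulr_ge0_le0//; near: t; exact: nbhs_right_ge.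
by rewrite ltrDl mulr_gt0//; near: t; exact: nbhs_right_gt.
Unshelve. all: by end_near. Qed.

Lemma near_affine_eq (a b c : R) :
  (\forall t \near 0^'+, a + t * b = c) -> a = c.
Proof.
move=> h; apply/eqP; rewrite eq_le; apply/andP; split.
  by apply: (@near_affine_le a b); apply: filterS h => t ->.
rewrite -lerN2; apply: (@near_affine_le _ (- b)); apply: filterS h => t <-.
by rewrite mulrN -opprD.
Qed.

(** Finitely many thresholds have a positive minimum. *)
Lemma near_seq (T : eqType) (s : seq T) (P : T -> R -> Prop) :
  (forall x, x \in s -> \forall t \near 0^'+, P x t) ->
  \forall t \near 0^'+, forall x, x \in s -> P x t.
Proof.
elim: s => [|y s IH] h; first exact: nearW.
have hs : \forall t \near 0^'+, forall x, x \in s -> P x t.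
  by apply: IH => x xs; apply: h; rewrite inE xs orbT.
apply: filterS2 (h y (mem_head _ _)) hs => t Py Ps x.
by rewrite inE => /predU1P[->|/Ps].
Qed.

End Near.

(** * Polyhedra and their cores *)

Section Polyhedra.
Context {R : realType} {d : nat}.
Notation V := 'rV[R]_d.
Implicit Types (P : set V) (u v w x y z : V).

Lemma polyhedron_ray P x v : polyhedron P ->
  (\forall t \near 0^'+, P (x + t *: v)) \/
  (\forall t \near 0^'+, ~ P (x + t *: v)).
Proof.
move=> /polyhedron_dot[n [a [b ->]]].
have dec i := near_affine_dec (dot (a i) x) (dot (a i) v) (b i).
have [h|/existsNP[i h]] := pselect (forall i,
  \forall t \near 0^'+, dot (a i) x + t * dot (a i) v <= b i); [left|right].
  by apply: filter_forall => i; apply: filterS (h i) => t; rewrite dotDr dotZr.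
have [//|] := dec i; apply: filterS => t ht /(_ i).
by rewrite dotDr dotZr leNgt ht.
Qed.

Lemma polyhedron_closed P x v : polyhedron P ->
  (\forall t \near 0^'+, P (x + t *: v)) -> P x.
Proof.
move=> /polyhedron_dot[n [a [b ->]]] h i.
apply: (@near_affine_le _ _ (dot (a i) v)).
by apply: filterS h => t /(_ i); rewrite dotDr dotZr.
Qed.

Definition convex_subset P :=
  forall x y t, P x -> P y -> 0 <= t -> t <= 1 -> P (x + t *: (y - x)).

Lemma polyhedron_convex P : polyhedron P -> convex_subset P.
Proof.
move=> /polyhedron_dot[n [a [b ->]]] x y t Px Py t0 t1 i.
rewrite dotDr dotZr dotBr; have := Px i; have := Py i; nra.
Qed.

(** The algebraic interior: convexity and affinity are conditions on lines, for
    which this pointwise form, one direction at a time, is the convenient one. *)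
Definition core P : set V :=
  [set x | forall v, \forall t \near 0^'+, P (x + t *: v)].

Lemma core_sub P : core P `<=` P.
Proof. by move=> x /(_ 0)/filter_ex[t]; rewrite scaler0 addr0. Qed.

Lemma core_convex P : convex_subset P -> convex_subset (core P).
Proof.
move=> cP x y t cx cy t0 t1 v; apply: filterS2 (cx v) (cy v) => s Px Py.
have := cP _ _ _ Px Py t0 t1; congr P.
by apply/rowP => i; rewrite !mxE; ring.
Qed.

(** The segment in direction [v] around the new point is the image of one around
    [x] under the homothety of centre [y] and ratio [1 - t]. *)
Lemma core_toward P x y (t : R) : convex_subset P -> core P x -> P y -> 0 <= t < 1 ->
  core P (x + t *: (y - x)).
Proof.
move=> cP cx Py /andP[t0 t1] v; have := cx ((1 - t)^-1 *: v).
apply: filterS => s Ps.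
have := cP _ _ _ Ps Py t0 (ltW t1); congr P.
have h : 1 - t != 0 by rewrite gt_eqF// subr_gt0.
by apply/rowP => i; rewrite !mxE; field.
Qed.

Lemma core_ray P x v : convex_subset P -> core P x ->
  \forall t \near 0^'+, core P (x + t *: v).
Proof.
move=> cP cx; have [s [Ps s0]] := filter_ex (filterI (cx v) (nbhs_right_gt 0)).
near=> t.
have -> : x + t *: v = x + (t / s) *: (x + s *: v - x).
  by rewrite [x + _ - x]addrAC subrr add0r scalerA divfK// gt_eqF.
apply: core_toward => //; rewrite divr_ge0 ?(ltW s0)//=.
by rewrite ltr_pdivrMr// mul1r; near: t; exact: nbhs_right_lt.
Unshelve. all: by end_near. Qed.

Lemma full_dim_hull P x : has_dim P d -> affine_hull P x.
Proof.
move=> [y [M [Mf ->]]]; exists ((x - y) *m invmx M) => //.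
by rewrite mulmxKV ?row_free_unit -?row_free_unit// addrC subrK.
Qed.

Lemma has_dim_nonempty P k : has_dim P k -> exists x, P x.
Proof.
move=> [y [M [Mf hullP]]]; have : affine_hull P y.
  by rewrite hullP; exists 0 => //; rewrite mul0mx addr0.
move=> [[|n] [l [z [Pz]]]]; last by exists (z ord0).
by rewrite big_ord0 => /esym/eqP; rewrite oner_eq0.
Qed.

(** No proper constraint is an equality on all of [P], since otherwise [P] would
    lie in a hyperplane.  Taking midpoints one constraint after the other yields
    a point at which all the proper constraints are strict. *)
Lemma core_point P : polyhedron P -> has_dim P d -> exists p, core P p.
Proof.
move=> pP dP; have [q Pq] := has_dim_nonempty dP.
have cP := polyhedron_convex pP; have [n [a [b PE]]] := polyhedron_dot pP.
have Pab x i : P x -> dot (a i) x <= b i by rewrite PE; exact.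
have strict i : a i != 0 -> exists2 p, P p & dot (a i) p < b i.
  move=> a0; apply: contrapT => /forall2NP h.
  have hb x : dot (a i) x = b i.
    apply: (@affine_hull_dot _ _ P); last exact: full_dim_hull.
    move=> y Py; have [//|/negP] := h y; rewrite -leNgt => ?.
    by apply/eqP; rewrite eq_le Pab.
  by have := dot_gt0 a0; rewrite hb -(hb 0) dot0r ltxx.
have [p Pp pb] : exists2 p, P p & forall i, a i != 0 -> dot (a i) p < b i.
  suff: forall s : seq 'I_n, exists2 p, P p &
      forall i, i \in s -> a i != 0 -> dot (a i) p < b i.
    move=> /(_ (enum 'I_n))[p Pp pb]; exists p => // i.
    by apply: pb; rewrite mem_enum.
  elim=> [|j s [p Pp IH]]; first by exists q.
  have [aj|aj] := eqVneq (a j) 0.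
    exists p => // i; rewrite inE => /orP[/eqP->|/IH//]; by rewrite aj eqxx.
  have [r Pr rj] := strict j aj; exists (p + 2^-1 *: (r - p)).
    by apply: cP => //; lra.
  move=> i; rewrite inE dotDr dotZr dotBr => /orP[/eqP-> _|/IH h /h].
    have := Pab _ j Pp; lra.
  have := Pab _ i Pr; lra.
exists p => v; rewrite PE/=; apply: filter_forall => i.
have [ai|ai] := eqVneq (a i) 0.
  by have := Pab _ i Pp; rewrite ai !dot0l => ?; apply: nearW => t; rewrite dot0l.
have := near_affine_lt (dot (a i) v) (pb i ai); apply: filterS => t.
by rewrite dotDr dotZr; exact: ltW.
Qed.

End Polyhedra.

(** * The local structure of a complete complex *)

Section Complexes.
Context {R : realType} {d : nat}.
Notation V := 'rV[R]_d.
Implicit Types (P S F : set V) (C : set (set V)) (phi : V -> R).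
Implicit Types (a e u v w x y z : V).

(** Locally, affinity and convexity are tested on symmetric second differences:
    they depend linearly on [phi] and vanish on affine functions. *)
Definition sdiff phi z v := phi (z + v) + phi (z - v) - 2 * phi z.

Definition locally_affine phi z :=
  forall v, \forall t \near 0^'+, sdiff phi z (t *: v) = 0.

(** [F] lies in a hyperplane whose direction contains [v]. *)
Definition flat_along v F := exists a b,
  [/\ a != 0, dot a v = 0 & forall x, F x -> dot a x = b].

(** For a set with nonempty affine hull this means that the hull has codimension
    at least 2: then every line direction is contained in the direction of some
    hyperplane containing [F]. *)
Definition thin F := forall v, flat_along v F.

Definition minimal_cell C S z :=
  [/\ C S, S z & forall P, C P -> P z -> S `<=` P].

Section Fixed.
Variable C : set (set V).
Hypothesis hC : polyhedral_complex C.

Lemma cell_polyhedron P : C P -> polyhedron P.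
Proof. by case: hC => -[_ + _ _ _] _; apply. Qed.

Lemma cell_face P F : C P -> face P F -> C F.
Proof. by case: hC => -[_ _ _ + _] _; apply. Qed.

Lemma cell_inter P F : C P -> C F -> face P (P `&` F).
Proof. by move=> CP CF; case: hC => -[_ _ _ _ /(_ P F CP CF)[]]. Qed.

Lemma cells_seq : exists s : seq (set V), forall P, (P \in s) = `[< C P >].
Proof.
case: hC => -[/finite_seqP[s ->] _ _ _ _] _; exists s => P.
by apply/idP/asboolP.
Qed.

Lemma cover_dcell x : exists2 P, cells C d P & P x.
Proof.
case: hC => _ [pure cov]; have : setT x by [].
rewrite -cov => -[P CP Px]; have [P' CP' PP'] := pure _ CP.
by exists P' => //; exact: PP'.
Qed.

(** The intersection of all the cells through [z], which are finitely many and
    of which any two intersect in a cell. *)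
Lemma minimal_cell_exists z : exists S, minimal_cell C S z.
Proof.
have [s sE] := cells_seq.
suff [S [CS Sz Sm]] : exists S, [/\ C S, S z &
    forall P, P \in s -> P z -> S `<=` P].
  by exists S; split=> // P CP; apply: Sm; rewrite sE; apply/asboolP.
have {sE} : forall P, P \in s -> C P by move=> P; rewrite sE => /asboolP.
elim: s => [_|P s IH sC].
  by have [P [CP _] Pz] := cover_dcell z; exists P.
have [|S [CS Sz Sm]] := IH.
  by move=> Q Qs; apply: sC; rewrite inE Qs orbT.
have CP : C P by apply: sC; rewrite mem_head.
have [Pz|Pz] := pselect (P z); last first.
  by exists S; split=> // Q; rewrite inE => /predU1P[->//|]; exact: Sm.
exists (P `&` S); split=> //; first exact: cell_face (cell_inter CP CS).
move=> Q; rewrite inE => /predU1P[->|Qs] Qz x [Px Sx] //.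
exact: Sm Qz _ Sx.
Qed.

(** Otherwise all d-cells, being finitely many, would miss a common initial
    segment of the ray, in contradiction with completeness. *)
Lemma cover_ray x v :
  exists2 P, cells C d P & \forall t \near 0^'+, P (x + t *: v).
Proof.
apply: contrapT => /forall2NP h; have [s sE] := cells_seq.
have : \forall t \near 0^'+, forall P,
    P \in s -> cells C d P -> ~ P (x + t *: v).
  apply: near_seq => P; rewrite sE => /asboolP CP.
  have [nP|hP] := h P; first by apply: nearW.
  have [//|] := @polyhedron_ray _ _ _ x v (cell_polyhedron CP).
  by apply: filterS => t + _.
move=> /filter_ex[t ht]; have [P CP Px] := cover_dcell (x + t *: v).
by apply: (ht P) => //; rewrite sE; apply/asboolP; case: CP.
Qed.

Lemma compatible_ray phi x v : compatible C phi ->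
  exists k, \forall t \near 0^'+, phi (x + t *: v) = phi x + t * k.
Proof.
move=> cphi; have [P [CP _] Pt] := cover_ray x v.
have Px := polyhedron_closed (cell_polyhedron CP) Pt.
have [a [b ab]] := cphi P CP; exists (dot a v); apply: filterS Pt => t Pt.
by rewrite !ab// dotDr dotZr addrAC.
Qed.

(** [z] lies in the relative interior of the smallest cell [S] through it: a
    constraint of [S] that is active at [z] cuts out a face of [S] through [z],
    which is a cell and so contains [S].  Hence the active constraints are
    equalities on [S], and near [z] they alone describe [S]; the rows of [M] span
    their common kernel. *)
Lemma minimal_cell_dim S z : minimal_cell C S z ->
  exists k (M : 'M[R]_(k, d)), [/\ row_free M,
    affine_hull S = [set z + u *m M | u in setT] &
    forall u : 'rV_k, \forall t \near 0^'+, S (z + t *: (u *m M))].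
Proof.
move=> [CS Sz Smin]; have [n [a [b SE]]] := polyhedron_dot (cell_polyhedron CS).
pose act i := dot (a i) z == b i.
have Sab x i : S x -> dot (a i) x <= b i by rewrite SE; exact.
have Sact i x : act i -> S x -> dot (a i) x = b i.
  move=> ai Sx; have [L LE] := dot_scalar (a i).
  have fL : face S (S `&` [set y | L y = b i]).
    by exists L, (b i); split=> // y Sy; rewrite LE Sab.
  have zL : (S `&` [set y | L y = b i]) z by split=> //=; rewrite LE; exact/eqP.
  by have [_ /=] := Smin _ (cell_face CS fL) zL _ Sx; rewrite LE.
pose A : 'M[R]_(d, n) := \matrix_(j, i) (if act i then a i 0 j else 0).
have AE v i : (v *m A) 0 i = if act i then dot (a i) v else 0.
  rewrite mxE; case: ifP => ai; last first.
    by rewrite big1// => j _; rewrite mxE ai mulr0.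
  by apply: eq_bigr => j _; rewrite mxE ai mulrC.
exists (\rank (kermx A)), (row_base (kermx A)).
have near_S v : v *m A = 0 -> \forall t \near 0^'+, S (z + t *: v).
  move=> vA; rewrite SE/=; apply: filter_forall => i.
  have [ai|ai] := boolP (act i).
    apply: nearW => t; rewrite dotDr dotZr; have := AE v i.
    by rewrite vA mxE ai => <-; rewrite mulr0 addr0 Sab.
  have zi : dot (a i) z < b i by rewrite lt_neqAle ai Sab.
  apply: filterS (near_affine_lt (dot (a i) v) zi) => t.
  by rewrite dotDr dotZr; exact: ltW.
have Mker (u : 'rV_(\rank (kermx A))) : (u *m row_base (kermx A)) *m A = 0.
  by apply/sub_kermxP; rewrite -(eq_row_base (kermx A)) submxMl.
split; first exact: row_base_free.
- apply/seteqP; split=> [x Sx|_ [u _ <-]].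
    have : (x - z <= kermx A)%MS.
      apply/sub_kermxP/rowP => i; rewrite AE mxE; case: ifP => // ai.
      rewrite dotBr (affine_hull_dot (b := b i) _ Sx) => [|y Sy]; last exact: Sact.
      by rewrite Sact// subrr.
    rewrite -(eq_row_base (kermx A)) => /submxP[u uE].
    by exists u => //; rewrite -uE addrC subrK.
  have [t [St t0]] := filter_ex (filterI (near_S _ (Mker u)) (nbhs_right_gt 0)).
  (* Rescaling: a point of the kernel far from [z] is an affine combination of
     [z] and a point of [S] close to [z]. *)
  exists 2%N, (fun i => if i == ord0 then 1 - t^-1 else t^-1),
    (fun i => if i == ord0 then z else z + t *: (u *m row_base (kermx A))).
  split; first by move=> i; case: ifP.
    by rewrite big_ord_recl big_ord1/= subrK.
  rewrite big_ord_recl big_ord1/= scalerDr scalerA mulVf ?gt_eqF// scale1r addrA.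
  by rewrite -scalerDl subrK scale1r.
- by move=> u; exact: near_S.
Qed.

(** A normal to both the rows of [M] and [v] exists by [normal_exists]. *)
Lemma minimal_cell_flat S z k (M : 'M[R]_(k, d)) v :
  affine_hull S = [set z + u *m M | u in setT] -> (\rank (col_mx M v) < d)%N ->
  flat_along v S.
Proof.
move=> hullS /normal_exists[a a0 aM]; exists a, (dot a z); split=> //.
  by have := aM (row_mx 0 1); rewrite mul_row_col mul0mx add0r mul1mx.
move=> x /sub_affine_hull; rewrite hullS => -[u _ <-]; rewrite dotDr.
by have := aM (row_mx u 0); rewrite mul_row_col mul0mx addr0 => ->; rewrite addr0.
Qed.

Lemma full_rank_core S z (M : 'M[R]_d) : row_free M ->
  (forall u, \forall t \near 0^'+, S (z + t *: (u *m M))) -> core S z.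
Proof.
move=> Mf Snear v.
by rewrite -(mulmxKV (_ : M \in unitmx) v) -?row_free_unit.
Qed.

Lemma minimal_cell_core S z : minimal_cell C S z -> ~ flat_along 0 S ->
  has_dim S d /\ core S z.
Proof.
move=> Smin nflat; have [k [M [Mf hullS Snear]]] := minimal_cell_dim Smin.
have Mk : \rank M = k by apply/eqP.
have kd : k = d.
  apply/eqP; rewrite eqn_leq -{1}Mk rank_leq_col leqNgt; apply/negP => kd.
  by apply/nflat/(minimal_cell_flat hullS); rewrite rank_col_mx0 Mk.
subst k; split=> [|v]; first by exists z, M.
exact: full_rank_core Snear v.
Qed.

Lemma sdiff_affine_on (X : set V) phi z v : affine_on X phi -> X z ->
  (\forall t \near 0^'+, X (z + t *: v)) ->
  (\forall t \near 0^'+, X (z + t *: - v)) ->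
  \forall t \near 0^'+, sdiff phi z (t *: v) = 0.
Proof.
move=> [a [b ab]] Xz; apply: filterS2 => t Xp Xm.
rewrite /sdiff -scalerN !ab// !dotDr !dotZr !dotNr; ring.
Qed.

(** In this section [S] is a wall, [z] a relative interior point of it and [e] a
    unit normal.  The aim is that the complex looks near [z] like two half-spaces
    glued along [S], so that a function of weight 0 on [S] is affine near [z]. *)
Section Wall.
Variables (S : set V) (z e : V).
Hypothesis Smin : minimal_cell C S z.
Hypothesis e1 : dot e e = 1.
Hypothesis Sflat : forall s, S s -> dot e (s - z) = 0.
Hypothesis Snear : forall v, dot e v = 0 -> \forall t \near 0^'+, S (z + t *: v).

Lemma form_normal l v : (forall w, dot e w = 0 -> dot l w = 0) ->
  dot l v = dot e v * dot l e.
Proof.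
move=> le; have : dot l (v - dot e v *: e) = 0.
  by apply: le; rewrite dotBr dotZr e1 mulr1 subrr.
by rewrite dotBr dotZr => /eqP; rewrite subr_eq0 => /eqP.
Qed.

(** A form cutting out [S] as a face of [P] is constant on [S], hence vanishes on
    the hyperplane normal to [e]. *)
Lemma wall_face P : C P -> P z -> exists l b,
  [/\ forall x, P x -> dot l x <= b, S = P `&` [set x | dot l x = b] &
      forall v, dot l v = dot e v * dot l e].
Proof.
move=> CP Pz; case: Smin => CS Sz /(_ P CP Pz) SP.
have [L [b [Lb LE]]] := cell_inter CP CS; have [l lE] := scalar_dot L.
have SE : S = P `&` [set x | dot l x = b].
  rewrite -[LHS](_ : P `&` S = S); last exact/setIidPr.
  rewrite LE; apply/seteqP; split=> x [Px]/=; rewrite ?lE => Lx.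
    by split.
  by split=> //=; rewrite lE.
have Sl x : S x -> dot l x = b by rewrite SE => -[].
exists l, b; split=> // [x Px|v]; first by rewrite -lE Lb.
apply: form_normal => w ew.
have [t [St t0]] := filter_ex (filterI (Snear ew) (nbhs_right_gt 0)).
have := Sl _ St; rewrite dotDr dotZr Sl// => /eqP.
by rewrite addrC -subr_eq0 addrK mulf_eq0 gt_eqF//= => /eqP.
Qed.

(** A form cutting out the face [S] of [P] would be bounded above on both sides
    of the wall, hence zero, which makes [S] equal to [P]. *)
Lemma wall_one_side P v w : C P -> P z -> P (z + v) -> P (z + w) ->
  0 < dot e v -> dot e w < 0 -> False.
Proof.
move=> CP Pz Pv Pw ev ew; have [l [b [lb SE le]]] := wall_face CP Pz.
have lz : dot l z = b by case: Smin => _; rewrite SE => -[].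
have := lb _ Pw; have := lb _ Pv; rewrite !dotDr lz !gerDl (le v) (le w).
rewrite pmulr_rle0// nmulr_rle0// => l0 l0'.
have l00 : dot l e = 0 by apply/eqP; rewrite eq_le l0 l0'.
have /Sflat : S (z + v).
  by rewrite SE; split=> //=; rewrite dotDr lz (le v) l00 mulr0 addr0.
by rewrite addrAC subrr add0r => ev0; rewrite ev0 ltxx in ev.
Qed.

(** The two d-cells entered from [z] along [e] and along [- e].  This also shows
    that the default value of [weight] is not taken at a wall. *)
Lemma wall_dcells : exists P P',
  [/\ cells C d P, cells C d P', S = P `&` P' & unit_normal P S e].
Proof.
have [P CP Pe] := cover_ray z e; have [P' CP' Pe'] := cover_ray z (- e).
have Pz := polyhedron_closed (cell_polyhedron CP.1) Pe.
have P'z := polyhedron_closed (cell_polyhedron CP'.1) Pe'.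
have [t [Pt t0]] := filter_ex (filterI Pe (nbhs_right_gt 0)).
have [t' [Pt' t0']] := filter_ex (filterI Pe' (nbhs_right_gt 0)).
have te : 0 < dot e (t *: e) by rewrite dotZr e1 mulr1.
have te' : dot e (t' *: - e) < 0 by rewrite dotZr dotNr e1 mulrN1 oppr_lt0.
have [CS Sz SP] := Smin.
exists P, P'; split=> //.
- apply/seteqP; split=> [x Sx|p [Pp P'p]].
    by split; [exact: (SP _ CP.1)|exact: (SP _ CP'.1)].
  have pz : p = z + (p - z) by rewrite addrC subrK.
  have [ep|ep|ep] := ltgtP (dot e (p - z)) 0.
  + by exfalso; apply: (wall_one_side CP.1 Pz Pt _ te ep); rewrite -pz.
  + by exfalso; apply: (wall_one_side CP'.1 P'z _ Pt' ep te'); rewrite -pz.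
  have [l [b [lb SE le]]] := wall_face CP.1 Pz.
  have lz : dot l z = b by move: Sz; rewrite SE => -[].
  by rewrite SE; split=> //=; rewrite pz dotDr lz (le (p - z)) ep mul0r addr0.
- split=> // [x y Sx Sy|]; last by exists z, t.
  have hull w : affine_hull S w -> dot e w = dot e z.
    apply: affine_hull_dot => s /Sflat; rewrite dotBr => /eqP.
    by rewrite subr_eq0 => /eqP.
  by rewrite dotBr (hull x) ?(hull y)// subrr.
Qed.

(** A cell through [z] reaching one side of the wall contains the whole half-ball
    on that side, as the convex hull of a segment and of a neighbourhood of [z]
    in [S].  The normal [f] stands for [e] or [- e], to serve both sides. *)
Lemma wall_half_space (P : set V) (f v u : V) : C P -> P z ->
  (forall w, dot f w = 0 -> dot e w = 0) ->
  P (z + v) -> 0 < dot f v -> 0 <= dot f u ->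
  \forall t \near 0^'+, P (z + t *: u).
Proof.
move=> CP Pz fe Pv fv fu; pose c := dot f u / dot f v.
have c0 : 0 <= c by rewrite divr_ge0// ltW.
have cP := polyhedron_convex (cell_polyhedron CP).
have SP : S `<=` P by case: Smin => _ _; exact.
have /Snear nw : dot e (2 *: (u - c *: v)) = 0.
  rewrite dotZr fe ?mulr0// dotBr dotZr divfK ?subrr// gt_eqF//.
near=> t.
(* The midpoint of a point of the segment from [z] to [z + v] and of a point of
   the wall. *)
have -> : z + t *: u = (z + (2 * t * c) *: (z + v - z))
    + 2^-1 *: (z + t *: (2 *: (u - c *: v)) - (z + (2 * t * c) *: (z + v - z))).
  by apply/rowP => i; rewrite !mxE; field.
have t0 : 0 <= t by [].
apply: (cP); [|apply: SP; near: t; exact: nw|lra|lra].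
apply: cP => //; first by apply: mulr_ge0 => //; apply: mulr_ge0.
rewrite -[2 * t * c]add0r mulrAC [2 * c * t]mulrC.
by apply: ltW; near: t; apply: near_affine_lt.
Unshelve. all: by end_near. Qed.

Lemma dcell_off_wall P : has_dim P d -> exists2 p, P p & dot e (p - z) != 0.
Proof.
move=> dP; apply: contrapT => /forall2NP h.
have : dot e (z + e) = dot e z.
  apply: (affine_hull_dot _ (full_dim_hull _ dP)) => p Pp.
  have [//|/negP] := h p; rewrite negbK dotBr subr_eq0 => /eqP//.
by rewrite dotDr e1 => /eqP; rewrite -subr_eq0 addrAC subrr add0r oner_eq0.
Qed.

(** Each of the two cells leaves the hyperplane of the wall.  They do so on
    opposite sides: a common side would contain points of [P `&` P'] off [S]. *)
Lemma wall_dcells_cover P P' u : cells C d P -> cells C d P' -> S = P `&` P' ->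
  \forall t \near 0^'+, (P `|` P') (z + t *: u).
Proof.
move=> CP CP' SE; have Sz : S z by case: Smin.
have [Pz P'z] : P z /\ P' z by rewrite SE in Sz.
have [p Pp ep] := dcell_off_wall CP.2; have [q Pq eq] := dcell_off_wall CP'.2.
have pz x : x = z + (x - z) by rewrite addrC subrK.
rewrite (pz p) in Pp; rewrite (pz q) in Pq.
have eNe w : dot (- e) w = 0 -> dot e w = 0.
  by rewrite dotC dotNr dotC => /eqP; rewrite oppr_eq0 => /eqP.
have Ne w : dot (- e) w = - dot e w by rewrite dotC dotNr dotC.
wlog ep0 : P P' p q CP CP' SE Pz P'z Pp Pq ep eq / 0 < dot e (p - z).
  move=> H; have [|ep0] := ltP 0 (dot e (p - z)); first exact: (H P P' p q).
  have [eq0|eq0] := ltP 0 (dot e (q - z)).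
    by rewrite setUC; apply: (H P' P q p) => //; rewrite setIC.
  have f1 : 0 < dot (- e) (p - z) by rewrite Ne oppr_gt0 lt_neqAle ep.
  have f2 : 0 < dot (- e) (q - z) by rewrite Ne oppr_gt0 lt_neqAle eq.
  have f3 : 0 <= dot (- e) (- e) by exact: dot_ge0.
  have [t [[h1 h2] t0]] := filter_ex (filterI (filterI
    (wall_half_space CP.1 Pz eNe Pp f1 f3)
    (wall_half_space CP'.1 P'z eNe Pq f2 f3))
    (nbhs_right_gt 0)).
  have /Sflat : S (z + t *: - e) by rewrite SE.
  rewrite addrAC subrr add0r dotZr dotNr e1 => /eqP.
  by rewrite mulf_eq0 oppr_eq0 oner_eq0 orbF gt_eqF.
have [eq0|eq0] := ltP 0 (dot e (q - z)).
  have f3 : 0 <= dot e e by exact: dot_ge0.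
  have [t [[h1 h2] t0]] := filter_ex (filterI (filterI
    (wall_half_space CP.1 Pz (fun _ => id) Pp ep0 f3)
    (wall_half_space CP'.1 P'z (fun _ => id) Pq eq0 f3))
    (nbhs_right_gt 0)).
  have /Sflat : S (z + t *: e) by rewrite SE.
  rewrite addrAC subrr add0r dotZr e1 => /eqP.
  by rewrite mulf_eq0 oner_eq0 orbF gt_eqF.
have [eu|eu] := leP 0 (dot e u).
  by apply: filterS (wall_half_space CP.1 Pz (fun _ => id) Pp ep0 eu) => t; left.
have f2 : 0 < dot (- e) (q - z) by rewrite Ne oppr_gt0 lt_neqAle eq.
have f4 : 0 <= dot (- e) u by rewrite Ne oppr_ge0 ltW.
by apply: filterS (wall_half_space CP'.1 P'z eNe Pq f2 f4) => t; right.
Qed.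

(** The difference of the two gradients is normal to the wall because the two
    affine pieces agree on it, and its normal component is the weight.  So the
    two pieces coincide when the weight is 0. *)
Lemma weight0_locally_affine phi : compatible C phi -> weight C phi S = 0 ->
  locally_affine phi z.
Proof.
move=> cphi w0.
have : is_weight C phi S (weight C phi S).
  apply: xgetPex; have [P [P' [CP CP' SE un]]] := wall_dcells.
  have [a [b ab]] := cphi P CP.1; have [a' [b' ab']] := cphi P' CP'.1.
  exists (dot e (a - a')), P, P', e, a, a'.
  by do !split=> //; [exists b|exists b'].
rewrite w0 => -[P [P' [e' [a [a' [[CP CP' SE]
  [[e'1 e'S _] [b ab] [b' ab'] w]]]]]]].
have [CS Sz _] := Smin; have [Pz P'z] : P z /\ P' z by rewrite SE in Sz.
have e'E v : dot e' v = dot e v * dot e' e.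
  apply: form_normal => u eu.
  have [t [St t0]] := filter_ex (filterI (Snear eu) (nbhs_right_gt 0)).
  have := e'S _ _ (sub_affine_hull St) (sub_affine_hull Sz).
  rewrite addrAC subrr add0r dotZr => /eqP.
  by rewrite mulf_eq0 gt_eqF//= => /eqP.
have aE v : dot (a - a') v = dot e v * dot (a - a') e.
  apply: form_normal => u eu.
  have [t [St t0]] := filter_ex (filterI (Snear eu) (nbhs_right_gt 0)).
  have [Pt P't] : P (z + t *: u) /\ P' (z + t *: u) by rewrite SE in St.
  have : t * dot (a - a') u = 0.
    have := ab _ Pt; rewrite ab'//; have := ab _ Pz; rewrite ab'//.
    rewrite !dotDr !dotZr dotBl; lra.
  by move=> /eqP; rewrite mulf_eq0 gt_eqF//= => /eqP.
have ae : dot (a - a') e = 0.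
  have e'e : dot e' e != 0.
    by apply: contra_eqN e'1 => /eqP h; rewrite e'E h mulr0 eq_sym oner_eq0.
  move/esym: w; rewrite dotC aE (dotC e) => /eqP.
  by rewrite mulf_eq0 (negPf e'e)/= => /eqP.
have aa' v : dot a' v = dot a v.
  by apply/eqP; rewrite eq_sym -subr_eq0 -dotBl aE ae mulr0.
have aff : affine_on (P `|` P') phi.
  exists a, b => x [/ab//|/ab' ->]; rewrite aa'; congr (_ + _).
  by have := ab _ Pz; rewrite ab'// aa' => /addrI.
by move=> v; apply: sdiff_affine_on aff _ _ _; [left|exact: wall_dcells_cover..].
Qed.

End Wall.

(** Outside the cells of codimension at least 2, a point is either in the
    interior of a d-cell or in the relative interior of a wall. *)
Theorem locally_affine_off_thin (g h : V -> R) z :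
  compatible C g -> compatible C h ->
  (forall S, walls C S -> weight C g S = 0 \/ weight C h S = 0) ->
  (forall F, C F -> thin F -> ~ F z) ->
  locally_affine g z \/ locally_affine h z.
Proof.
move=> cg ch gh nthin; have [S Smin] := minimal_cell_exists z.
have [k [M [Mf hullS Snear]]] := minimal_cell_dim Smin.
have [CS Sz _] := Smin.
have Mk : \rank M = k by apply/eqP.
have kd : (k <= d)%N by rewrite -{1}Mk rank_leq_col.
have [kd0|kd0] := eqVneq k d.
  subst k; left=> v; apply: sdiff_affine_on (cg _ CS) _ _ _ => //;
    exact: full_rank_core Snear _.
have [kd1|kd1] := eqVneq k.+1 d.
  have [e e1 eM] := hyperplane_normal Mf kd1.
  have Sflat s : S s -> dot e (s - z) = 0.
    move=> /sub_affine_hull; rewrite hullS => -[u _ <-].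
    by rewrite addrAC subrr add0r; apply/eM; exists u.
  have Sn v : dot e v = 0 -> \forall t \near 0^'+, S (z + t *: v).
    by move=> /eM[u ->].
  have wS : walls C S by exists k => //; split=> //; exists z, M.
  by have [w|w] := gh S wS; [left|right];
    exact: (weight0_locally_affine Smin e1 Sflat Sn _ w).
case: (nthin S CS) => // v.
apply: (minimal_cell_flat hullS); apply: leq_ltn_trans (rank_leq_row _) _.
by rewrite addn1 ltn_neqAle kd1 ltn_neqAle kd0.
Qed.

End Fixed.
End Complexes.

(** * From local to global convexity *)

Section Line.
Context {R : realType}.

(** Otherwise subtract the chord and add a small multiple of [s * s - s].  The
    result [q] vanishes at 0 and 1, is positive somewhere and has positive second
    differences, so it cannot have a maximum in the open interval. *)
Lemma line_convex (f : R -> R) : continuous f ->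
  (forall s, 0 < s < 1 ->
    \forall t \near 0^'+, 0 <= f (s + t) + f (s - t) - 2 * f s) ->
  forall r, 0 <= r <= 1 -> f r <= f 0 + r * (f 1 - f 0).
Proof.
move=> cf lf r r01; rewrite leNgt; apply/negP => rlt.
pose D := f r - f 0 - r * (f 1 - f 0).
have D0 : 0 < D by rewrite /D; lra.
pose q s := f s - f 0 - s * (f 1 - f 0) + D * (s * s - s).
have cq : continuous q.
  move=> s; apply: cvgD; last first.
    by apply: cvgMr; apply: cvgB; [apply: cvgM|]; exact: cvg_id.
  apply: cvgB; last by apply: cvgMl; exact: cvg_id.
  by apply: cvgB; [exact: cf|exact: cvg_cst].
have [c] := EVT_max ler01 (continuous_subspaceT cq).
rewrite in_itv/= => c01 qc.
have qr : 0 < q r.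
  have -> : q r = D * (1 - r + r * r) by rewrite /q /D; ring.
  by apply: mulr_gt0 => //; nra.
have qc0 : 0 < q c by apply: lt_le_trans qr _; apply: qc; rewrite in_itv.
have c0 : c != 0 by apply: contraTneq qc0 => ->; rewrite -leNgt /q; lra.
have c1 : c != 1 by apply: contraTneq qc0 => ->; rewrite -leNgt /q; lra.
have {c0 c1}c01' : 0 < c < 1.
  by case/andP: c01 => h0 h1; rewrite !lt_neqAle eq_sym c0 c1 h0.
have /andP[c0 c1] := c01'.
have d1 : 0 < 1 - c by lra.
have [t [[ft t0] [tc t1c]]] := filter_ex (filterI (filterI (lf c c01')
  (nbhs_right_gt 0)) (filterI (nbhs_right_lt c0) (nbhs_right_lt d1))).
have q1 : q (c + t) <= q c by apply: qc; rewrite in_itv/=; lra.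
have q2 : q (c - t) <= q c by apply: qc; rewrite in_itv/=; lra.
have : 0 < D * (t * t) by rewrite !mulr_gt0.
move: q1 q2; rewrite /q; nra.
Qed.

Lemma near_affine_neq (a b c : R) : a != c \/ b != 0 ->
  \forall t \near 0^'+, a + t * b != c.
Proof.
have [ac|ca|-> [|b0]] := ltgtP a c; rewrite ?eqxx//.
- by move=> _; apply: filterS (near_affine_lt b ac) => t /lt_eqF ->.
- move=> _; have h : - a < - c by rewrite ltrN2.
  apply: filterS (near_affine_lt (- b) h) => t.
  by rewrite mulrN -opprD ltrN2 => /gt_eqF ->.
apply: filterS (nbhs_right_gt 0) => t t0.
by rewrite -subr_eq0 addrAC subrr add0r mulf_neq0// gt_eqF.
Qed.

End Line.

Section LocalToGlobal.
Context {R : realType} {d : nat}.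
Notation V := 'rV[R]_d.
Implicit Types (P F : set V) (C : set (set V)) (a v w x y z : V) (phi : V -> R).

(** When [w] works for the vectors of [s], the vector [w + t a] works for those of
    [a :: s] as soon as [t > 0] is small. *)
Lemma generic_direction (s : seq V) : (forall a, a \in s -> a != 0) ->
  exists w, forall a, a \in s -> dot a w != 0.
Proof.
elim: s => [|a s IH] s0; first by exists 0.
have [|w wP] := IH; first by move=> b bs; apply: s0; rewrite inE bs orbT.
have a0 : dot a a != 0 by rewrite gt_eqF// dot_gt0// s0// mem_head.
have [t tP] : exists t : R, forall b, b \in a :: s -> dot b w + t * dot b a != 0.
  apply: (@filter_ex _ (0:R)^'+); apply: near_seq => b.
  by rewrite inE => /predU1P[->|bs]; apply: near_affine_neq; [right|left; exact: wP].
by exists (w + t *: a) => b bs; rewrite dotDr dotZr tP.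
Qed.

Definition ray_affine phi :=
  forall x v, exists k, \forall t \near 0^'+, phi (x + t *: v) = phi x + t * k.

Definition locally_convex phi z :=
  forall v, \forall t \near 0^'+, 0 <= sdiff phi z (t *: v).

(** Being affine on both sides of every point forces continuity on each line,
    which is what the extreme value theorem requires. *)
Lemma ray_affine_continuous phi z v : ray_affine phi ->
  continuous (fun r : R => phi (z + r *: v)).
Proof.
move=> aphi r; apply/left_right_continuousP.
have cv (k : R) : phi (z + r *: v) + t * k @[t --> 0^'+] --> phi (z + r *: v).
  rewrite -[X in _ --> X]addr0 -[X in _ --> _ + X](mul0r k).
  apply: cvgD; first exact: cvg_cst.
  apply: cvgMl; exact: cvg_at_right_filter cvg_id.
split=> U nU.
  apply/nbhs_left0P; have [k hk] := aphi (z + r *: v) (- v).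
  apply: filterS2 hk (cv k U nU) => t + Ut.
  by rewrite /= scalerN -scaleNr -addrA -scalerDl => ->.
apply/nbhs_right0P; have [k hk] := aphi (z + r *: v) v.
apply: filterS2 hk (cv k U nU) => t + Ut.
by rewrite /= -addrA -scalerDl => ->.
Qed.

(** Translating the line [x + R v] along [w] moves it across a given hyperplane
    parallel to [v] at one instant at most, provided [w] is not parallel to that
    hyperplane.  With [w] generic, only finitely many instants are excluded. *)
Lemma generic_translation C v x : finite_set C -> exists w,
  \forall t \near 0^'+, forall F, C F -> flat_along v F ->
    forall r, ~ F (x + t *: w + r *: v).
Proof.
move=> /finite_seqP[s ->].
have /choice[ab abP] : forall F, exists ab : V * R, flat_along v F ->
    [/\ ab.1 != 0, dot ab.1 v = 0 & forall x, F x -> dot ab.1 x = ab.2].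
  move=> F; have [[a [b h]]|nF] := pselect (flat_along v F).
    by exists (a, b).
  by exists (0, 0).
have [|w wP] := @generic_direction
    [seq (ab F).1 | F <- s & `[< flat_along v F >]].
  by move=> a /mapP[F]; rewrite mem_filter => /andP[/asboolP/abP[? _ _] _] ->.
exists w; apply: near_seq => F Fs.
have [tF|ntF] := pselect (flat_along v F); last exact: nearW.
have [_ av Fb] := abP F tF.
have h : dot (ab F).1 x != (ab F).2 \/ dot (ab F).1 w != 0.
  right; apply: wP; apply/mapP; exists F => //.
  by rewrite mem_filter Fs andbT; apply/asboolP.
apply: filterS (near_affine_neq h) => t /eqP tP _ r /Fb.
by rewrite !dotDr !dotZr av mulr0 addr0.
Qed.

(** Thin cells are negligible for convexity: a segment translated by [t w], for a
    generic [w] and small [t > 0], avoids them all, so that [line_convex] applies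
    to it.  As [phi] is affine along short rays, the inequality survives the limit
    [t -> 0]. *)
Theorem convex_local_to_global C P phi :
  finite_set C -> convex_subset P -> ray_affine phi ->
  (forall z, core P z -> (forall F, C F -> thin F -> ~ F z) ->
    locally_convex phi z) ->
  forall x y r, core P x -> core P y -> 0 <= r <= 1 ->
  phi (x + r *: (y - x)) <= phi x + r * (phi y - phi x).
Proof.
move=> fC cP aphi lphi x y r cx cy r01; set v := y - x.
have [w off] := generic_translation v x fC.
have segment : \forall t \near 0^'+, phi (x + r *: v + t *: w) <=
    phi (x + t *: w) + r * (phi (y + t *: w) - phi (x + t *: w)).
  apply: filterS (filterI off (filterI (core_ray w cP cx) (core_ray w cP cy))).
  move=> t [tP [cxt cyt]].
  have := @line_convex _ (fun r : R => phi (x + t *: w + r *: v)) _ _ r r01.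
  rewrite scale0r addr0 scale1r addrAC (addrAC x _ v) [x + v]addrC subrK.
  apply; first exact: ray_affine_continuous.
  move=> q /andP[q0 q1]; set z := x + t *: w + q *: v.
  have cz : core P z.
    have := core_convex cP cxt cyt (ltW q0) (ltW q1); congr (core P _).
    by apply/rowP => i; rewrite /z /v !mxE; ring.
  have zoff F : C F -> thin F -> ~ F z.
    by move=> CF tF; exact: tP.
  apply: filterS (lphi z cz zoff v) => u.
  by rewrite /sdiff scalerDl scalerBl !addrA.
have [k1 h1] := aphi (x + r *: v) w; have [k2 h2] := aphi x w.
have [k3 h3] := aphi y w.
rewrite -subr_le0.
apply: (@near_affine_le _ _ (k1 - k2 - r * (k3 - k2))).
apply: filterS2 (filterI h1 h2) (filterI h3 segment) => t /= [e1 e2] [e3].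
rewrite e1 e2 e3.
rewrite -subr_le0; apply: le_trans; rewrite le_eqVlt; apply/orP; left.
apply/eqP; ring.
Qed.
End LocalToGlobal.

(** * Convex and affine functions on cells *)

Section Convexity.
Context {R : realType} {d : nat}.
Notation V := 'rV[R]_d.
Implicit Types (P F : set V) (C Q : set (set V)) (a v w x y z : V).

Lemma convex_funP (phi : V -> R^o) : convex_fun phi <->
  forall x y (r : R), 0 <= r <= 1 ->
    phi (x + r *: (y - x)) <= phi x + r * (phi y - phi x).
Proof.
split=> [cphi x y r /andP[r0 r1]|cphi t x y _ _].
  have := cphi (Itv01 r0 r1) y x (in_setT _) (in_setT _).
  have -> : x + r *: (y - x) = conv (Itv01 r0 r1) (y : convex_lmodType V) x.
    rewrite /conv/= /onem; apply/rowP => i; rewrite !mxE; ring.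
  move=> /le_trans; apply; rewrite le_eqVlt; apply/orP; left; apply/eqP.
  rewrite convRE /onem/=; ring.
have t1 : 0 <= t%:num <= 1 by rewrite ge0 le1.
have := cphi y x t%:num t1.
have -> : y + t%:num *: (x - y) = conv t (x : convex_lmodType V) y.
  rewrite /conv/= /onem; apply/rowP => i; rewrite !mxE; ring.
move=> /le_trans; apply; rewrite le_eqVlt; apply/orP; left; apply/eqP.
rewrite convRE /onem/=; ring.
Qed.

Lemma convex_sdiff (phi : V -> R^o) z v : convex_fun phi -> 0 <= sdiff phi z v.
Proof.
move=> /convex_funP cphi; have := cphi (z + v) (z - v) 2^-1.
have -> : z + v + 2^-1 *: (z - v - (z + v)) = z.
  by apply/rowP => i; rewrite !mxE; field.
rewrite /sdiff => h; have {h} := h _; lra.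
Qed.

Lemma sdiff_affine (phi : V -> R^o) z v : is_affine phi -> sdiff phi z v = 0.
Proof.
by move=> [a [b ab]]; rewrite /sdiff !ab// dotDr dotBr; ring.
Qed.

Lemma sdiffB (phi psi : V -> R^o) z v :
  sdiff (phi - psi) z v = sdiff phi z v - sdiff psi z v.
Proof. by rewrite /sdiff !fctE; ring. Qed.

Lemma sdiffN (phi : V -> R^o) z v : sdiff (- phi) z v = - sdiff phi z v.
Proof.
have E x : (- phi) x = - phi x by [].
by rewrite /sdiff !E; ring.
Qed.

Lemma compatible_ray_affine C phi :
  polyhedral_complex C -> compatible C phi -> ray_affine phi.
Proof. by move=> hC cphi x v; exact: (compatible_ray hC). Qed.

Lemma ray_affineB (phi psi : V -> R^o) :
  ray_affine phi -> ray_affine psi -> ray_affine (phi - psi).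
Proof.
move=> h1 h2 x v; have [k1 e1] := h1 x v; have [k2 e2] := h2 x v.
by exists (k1 - k2); apply: filterS2 e1 e2 => t; rewrite !fctE => -> ->; ring.
Qed.

Lemma ray_affineN (phi : V -> R^o) : ray_affine phi -> ray_affine (- phi).
Proof.
move=> h x v; have [k e] := h x v.
by exists (- k); apply: filterS e => t; rewrite !fctE => ->; ring.
Qed.

Lemma complex_finite C : polyhedral_complex C -> finite_set C.
Proof. by case=> -[]. Qed.

(** The cells of positive codimension are contained in finitely many hyperplanes,
    and a core point of [P] can be moved off these. *)
Lemma generic_core_point C P :
  polyhedral_complex C -> polyhedron P -> has_dim P d ->
  exists p S, [/\ core P p, C S & core S p].
Proof.
move=> hC pP dP; have [q cq] := core_point pP dP.
have [w off] := generic_translation 0 q (complex_finite hC).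
have [t [cp offt]] :=
  filter_ex (filterI (core_ray w (polyhedron_convex pP) cq) off).
have [S Smin] := minimal_cell_exists hC (q + t *: w); exists (q + t *: w), S.
have [CS Sz _] := Smin; split=> //.
have [//|_ //] := minimal_cell_core hC Smin.
by move=> fS; apply: (offt S CS fS 0); rewrite scale0r addr0.
Qed.

(** The hypothesis [locGH] is the only trace of the weights of [G] and [H]: off
    the thin cells, one of the two functions is locally affine. *)
Section Decomposition.
Variables (C : set (set V)) (G H : V -> R^o).
Hypothesis hC : polyhedral_complex C.
Hypothesis cG : compatible C G.
Hypothesis kG : convex_fun G.
Hypothesis locGH : forall z, (forall F, C F -> thin F -> ~ F z) ->
  locally_affine G z \/ locally_affine H z.

(** Off the thin cells, [G - H] and one of [G] and [H] are locally affine in the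
    core of [P], hence [G] is.  So [- G] is locally convex there, hence convex,
    and the convex function [G] is affine on the segments of the core.  A single
    affine function comes from a point [p] around which [G] is known to be affine;
    following segments from [p] extends it to the core and then to [P]. *)
Lemma affine_on_difference P : polyhedron P -> has_dim P d ->
  affine_on P (G - H) -> affine_on P G.
Proof.
move=> pP dP aP; have cP := polyhedron_convex pP.
have rG := compatible_ray_affine hC cG.
have Gseg x y r : core P x -> core P y -> 0 <= r <= 1 ->
    G (x + r *: (y - x)) = G x + r * (G y - G x).
  move=> cx cy r01; apply/eqP; rewrite eq_le; apply/andP; split.
    by move/convex_funP: kG; apply.
  have := @convex_local_to_global _ _ C P (- G) (complex_finite hC) cP
    (ray_affineN rG).
  move=> /(_ _ x y r cx cy r01) h.
  have {h} : - G (x + r *: (y - x)) <= - G x + r * (- G y - - G x); last by lra.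
  apply: h => z cz zoff v.
  suff : \forall t \near 0^'+, sdiff G z (t *: v) = 0.
    by apply: filterS => t; rewrite sdiffN => ->; rewrite oppr0.
  have [|Hz] := locGH zoff; first exact.
  have := sdiff_affine_on aP (core_sub cz) (cz v) (cz (- v)).
  by apply: filterS2 (Hz v) => t; rewrite sdiffB => ->; rewrite subr0.
have [p [S [cp CS Sp]]] := generic_core_point hC pP dP.
have [a [b ab]] := cG CS.
have Gcore y : core P y -> G y = dot a y + b.
  move=> cy; have near01 : \forall t \near (0 : R)^'+, 0 <= t <= 1.
    by apply: filterS (filterI (nbhs_right_ge (0 : R))
      (nbhs_right_le (@ltr01 R))) => t [-> ->].
  have : G p - (dot a p + b) = 0 by rewrite (ab p (core_sub Sp)) subrr.
  have : \forall t \near 0^'+, 0 + t * (G y - (dot a y + b)) = 0.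
    (* [G] is affine both around [p] and on the segment from [p] to [y]. *)
  apply: filterS2 (Sp (y - p)) near01 => t /ab St t01.
    have := Gseg _ _ _ cp cy t01.
    by rewrite St dotDr dotZr dotBr (ab p (core_sub Sp)); lra.
  move=> /(filterI (nbhs_right_gt 0))/filter_ex[t [t0]].
  by rewrite add0r => /eqP; rewrite mulf_eq0 gt_eqF//= subr_eq0 => /eqP.
exists a, b => y Py; have [k hk] := rG y (p - y).
suff : \forall t \near 0^'+, G y + t * (k - dot a (p - y)) = dot a y + b.
  exact: near_affine_eq.
apply: filterS2 (filterI hk (nbhs_right_gt 0)) (nbhs_right_le (@ltr01 R)).
move=> t [ht t0] t1.
have : core P (y + t *: (p - y)).
  have -> : y + t *: (p - y) = p + (1 - t) *: (y - p).
    by apply/rowP => i; rewrite !mxE; ring.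
  by apply: core_toward => //; lra.
move=> /Gcore; rewrite ht dotDr dotZr; lra.
Qed.

Lemma compatible_difference Q : polyhedral_complex Q -> compatible Q (G - H) ->
  compatible Q G.
Proof.
move=> hQ cQ P QP; case: (hQ) => _ [pure _].
have [P' [QP' dP'] PP'] := pure P QP.
have [a [b ab]] := affine_on_difference (cell_polyhedron hQ QP') dP' (cQ _ QP').
by exists a, b => x /PP'/ab.
Qed.

(** Locally [G' - G] is [G'] up to an affine function where [G] is affine, and it
    is [H'] up to an affine function where [H] is affine. *)
Lemma convex_difference (G' H' : V -> R^o) : convex_fun G' -> convex_fun H' ->
  ray_affine G' -> is_affine ((G' - G) - (H' - H)) -> convex_fun (G' - G).
Proof.
move=> kG' kH' rG' aff; apply/convex_funP => x y r r01.
have cT : convex_subset (@setT V) by [].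
have rG := compatible_ray_affine hC cG.
apply: (convex_local_to_global (complex_finite hC) cT (ray_affineB rG' rG)) => //.
- move=> z _ zoff v; have [Gz|Hz] := locGH zoff.
    by apply: filterS (Gz v) => t h; rewrite sdiffB h subr0 convex_sdiff.
  apply: filterS (Hz v) => t h; have := sdiff_affine z (t *: v) aff.
  rewrite sdiffB [sdiff (H' - _) _ _]sdiffB h subr0 => /eqP.
  rewrite subr_eq0 => /eqP->.
  exact: convex_sdiff.
- by move=> v; exact: nearW.
- by move=> v; exact: nearW.
Qed.

End Decomposition.

(** The defect in Jensen's inequality at the point [x + r (y - x)]. *)
Definition gap (phi : V -> R^o) (s : V * V * R) : R :=
  let: (x, y, r) := s in phi x + r * (phi y - phi x) - phi (x + r *: (y - x)).

Lemma gap_affine phi s : is_affine phi -> gap phi s = 0.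
Proof.
by case: s => [[x y] r] [a [b ab]]; rewrite /gap !ab// dotDr dotZr dotBr; ring.
Qed.

Lemma gap_comb (k : R) phi psi s :
  gap (k *: phi + psi) s = k * gap phi s + gap psi s.
Proof.
case: s => [[x y] r]; rewrite /gap.
have E z : (k *: phi + psi) z = k * phi z + psi z by [].
by rewrite !E; ring.
Qed.

Lemma gap_ge0 phi s : convex_fun phi -> 0 <= s.2 <= 1 -> 0 <= gap phi s.
Proof.
by case: s => [[x y] r] /convex_funP cphi r01; rewrite subr_ge0 cphi.
Qed.

(** Fix a core point [p] of one d-cell [P0].  For each d-cell [P], with core point
    [q], take the segment from [p] to [q] and an intermediate point still in [P0].
    The affine extension of [phi] from [P0] minorizes the convex function [phi],
    and a zero gap means that it meets [phi] at [q].  The difference on [P] is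
    affine, nonnegative and zero at a core point, hence zero. *)
Lemma gaps_detect_affine Q : polyhedral_complex Q ->
  exists s : seq (V * V * R), (forall u, u \in s -> 0 <= u.2 <= 1) /\
    forall phi, compatible Q phi -> convex_fun phi ->
      (forall u, u \in s -> gap phi u = 0) -> is_affine phi.
Proof.
move=> hQ; have [P0 [QP0 dP0] _] := cover_dcell hQ (0 : V).
have [p cp] := core_point (cell_polyhedron hQ QP0) dP0.
have /choice[u uP] : forall P, exists u : V * V * R,
    0 <= u.2 <= 1 /\ (cells Q d P ->
    [/\ u.1.1 = p, core P u.1.2, 0 < u.2 & P0 (p + u.2 *: (u.1.2 - p))]).
  move=> P; have [[QP dP]|nP] := pselect (cells Q d P); last first.
    by exists (0, 0, 0); rewrite lexx ler01.
  have [q cq] := core_point (cell_polyhedron hQ QP) dP.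
  have [r [[Pr r0] r1]] := filter_ex (filterI
    (filterI (cp (q - p)) (nbhs_right_gt 0)) (nbhs_right_le (@ltr01 R))).
  by exists (p, q, r) => /=; rewrite ltW.
have [s sE] := cells_seq hQ; exists (map u s); split=> [_ /mapP[P _ ->]|].
  by have [] := uP P.
move=> phi cphi kphi phi0; have [a [b ab]] := cphi _ QP0.
have phip : phi p = dot a p + b by rewrite ab//; exact: core_sub.
have below x : dot a x + b <= phi x.
  have [r [[Pr r0] r1]] := filter_ex (filterI
    (filterI (cp (x - p)) (nbhs_right_gt 0)) (nbhs_right_le (@ltr01 R))).
  have r01 : 0 <= r <= 1 by rewrite ltW.
  have := (convex_funP phi).1 kphi p x r r01.
  rewrite ab// phip dotDr dotZr dotBr => h.
  have : r * (dot a x + b) <= r * phi x by lra.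
  by rewrite ler_pM2l.
exists a, b => x _; have [P [QP dP] Px] := cover_dcell hQ x.
have [_ /(_ (conj QP dP))[up cq r0 Pr]] := uP P.
have : gap phi (u P) = 0.
  by apply: phi0; apply: map_f; rewrite sE; apply/asboolP.
move: up cq r0 Pr; case: (u P) => [[p' q] r] /= -> cq r0 Pr.
rewrite (ab _ Pr) phip dotDr dotZr dotBr => h0.
have phiq : phi q = dot a q + b.
  have : r * (phi q - (dot a q + b)) = 0 by lra.
  by move=> /eqP; rewrite mulf_eq0 gt_eqF//= subr_eq0 => /eqP.
have [a' [b' ab']] := cphi _ QP.
have [t [Pt t0]] := filter_ex (filterI (cq (q - x)) (nbhs_right_gt 0)).
have := below (q + t *: (q - x)); have := below x.
have := phiq; rewrite (ab' q (core_sub cq)) (ab' x Px) (ab' _ Pt).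
rewrite !dotDr !dotZr !dotBr => e h1 h2.
apply/eqP; rewrite eq_le h1 andbT.
have : t * (dot a' x + b') <= t * (dot a x + b) by nra.
by rewrite ler_pM2l.
Qed.

End Convexity.

(** * Functions modulo affine functions *)

Section Classes.
Context {R : realType} {d : nat}.
Notation V := 'rV[R]_d.
Notation Fbar := (modAff R d).
Implicit Types (C Q : set (set V)) (f g h u v : Fbar) (phi psi : V -> R^o).

Lemma cls0 : cls (0 : V -> R^o) = 0.
Proof. by apply: (addrI (cls 0)); rewrite -clsD !addr0. Qed.

Lemma clsN phi : cls (- phi) = - cls phi.
Proof. by apply: (addrI (cls phi)); rewrite -clsD !subrr cls0. Qed.

Lemma clsB phi psi : cls (phi - psi) = cls phi - cls psi.
Proof. by rewrite clsD clsN. Qed.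

Lemma clsZ_scale (k : R) phi : cls (k *: phi) = k *: cls phi.
Proof. by rewrite -clsZ. Qed.

Lemma is_affine_cls phi : is_affine phi <-> cls phi = 0.
Proof. by rewrite -cls0 clsP subr0. Qed.

Lemma compatible_cls_eq C phi psi : cls phi = cls psi ->
  compatible C phi -> compatible C psi.
Proof.
move=> /esym/clsP[a' [b' ab']] cphi P CP; have [a [b ab]] := cphi P CP.
exists (a + a'), (b + b') => x Px; have := ab' x I.
by rewrite !fctE (ab x Px) dotDl; lra.
Qed.

Lemma convex_fun_cls_eq phi psi : cls phi = cls psi ->
  convex_fun phi -> convex_fun psi.
Proof.
move=> /esym/clsP[a [b ab]] /convex_funP cphi; apply/convex_funP => x y r r01.
have E z : psi z = phi z + (dot a z + b) by have := ab z I; rewrite !fctE; lra.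
have := cphi x y r r01; rewrite !E dotDr dotZr dotBr; lra.
Qed.

Lemma compatible_clsP C f : compatible_cls C f <-> compatible C (rep f).
Proof.
split=> [[phi cphi phif]|cf]; last by exists (rep f) => //; exact: repK.
by apply: compatible_cls_eq cphi; rewrite repK.
Qed.

Lemma convex_clsP C f :
  convex_cls C f <-> compatible C (rep f) /\ convex_fun (rep f).
Proof.
split=> [[phi [cphi kphi] phif]|cf]; last by exists (rep f) => //; exact: repK.
split; first by apply: compatible_cls_eq cphi; rewrite repK.
by apply: convex_fun_cls_eq kphi; rewrite repK.
Qed.

Lemma convex_cls_intro C phi :
  compatible C phi -> convex_fun phi -> convex_cls C (cls phi).
Proof. by move=> cphi kphi; exists phi. Qed.

Lemma compatibleD C phi psi :
  compatible C phi -> compatible C psi -> compatible C (phi + psi).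
Proof.
move=> h1 h2 P CP; have [a [b ab]] := h1 P CP; have [a' [b' ab']] := h2 P CP.
by exists (a + a'), (b + b') => x Px; rewrite !fctE ab// ab'// dotDl; ring.
Qed.

Lemma compatibleB C phi psi :
  compatible C phi -> compatible C psi -> compatible C (phi - psi).
Proof.
move=> h1 h2 P CP; have [a [b ab]] := h1 P CP; have [a' [b' ab']] := h2 P CP.
by exists (a - a'), (b - b') => x Px; rewrite !fctE ab// ab'// dotBl; ring.
Qed.

Lemma convex_funD phi psi :
  convex_fun phi -> convex_fun psi -> convex_fun (phi + psi).
Proof.
move=> /convex_funP h1 /convex_funP h2; apply/convex_funP => x y r r01.
have := h1 x y r r01; have := h2 x y r r01; rewrite !fctE; lra.
Qed.

Lemma convex_clsD C u v :
  convex_cls C u -> convex_cls C v -> convex_cls C (u + v).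
Proof.
move=> /convex_clsP[cu ku] /convex_clsP[cv kv]; rewrite -(repK u) -(repK v) -clsD.
by apply: convex_cls_intro; [exact: compatibleD|exact: convex_funD].
Qed.

Lemma gap_cls phi s : gap (rep (cls phi)) s = gap phi s.
Proof.
have /clsP/(gap_affine s) : cls (rep (cls phi)) = cls phi by rewrite repK.
rewrite -[X in gap X _](_ : -1 *: phi + rep (cls phi) = _); last first.
  by rewrite scaleN1r addrC.
by rewrite gap_comb mulN1r addrC => /eqP; rewrite subr_eq0 => /eqP.
Qed.

Lemma gap_cls_comb (k : R) u v s :
  gap (rep (k *: u + v)) s = k * gap (rep u) s + gap (rep v) s.
Proof.
by rewrite -{1}(repK u) -{1}(repK v) -clsZ_scale -clsD gap_cls gap_comb.
Qed.

Lemma gap_clsD u v s : gap (rep (u + v)) s = gap (rep u) s + gap (rep v) s.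
Proof. by rewrite -[u]scale1r gap_cls_comb mul1r scale1r. Qed.

(** The minimum for [phi] ranges over fewer complexes.  The first hypothesis keeps
    the default value 0 out of the way. *)
Lemma num_pieces_le phi psi :
  (exists2 C, polyhedral_complex C & compatible C phi) ->
  (forall Q, polyhedral_complex Q -> compatible Q phi -> compatible Q psi) ->
  (num_pieces psi <= num_pieces phi)%N.
Proof.
move=> [C hC cphi] sub.
pose N (F : V -> R^o) := [set n | exists C,
  [/\ polyhedral_complex C, compatible C F & (cells C d #= `I_n)%card]].
have minN (F : V -> R^o) : (exists n, N F n) ->
    N F (num_pieces F) /\ forall m, N F m -> (num_pieces F <= m)%N.
  move=> [n Nn]; have exN : exists n, `[< N F n >] by exists n; exact/asboolP.
  apply: (@xgetPex _ 0%N [set n | N F n /\ forall m, N F m -> (n <= m)%N]).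
  exists (ex_minn exN); case: ex_minnP => m /asboolP Nm mle.
  by split=> // l Nl; apply: mle; exact/asboolP.
have Nphi : exists n, N phi n.
  have [n cn] : finite_set (cells C d).
    by apply: sub_finite_set (complex_finite hC) => P [].
  by exists n, C.
have Npsi n : N phi n -> N psi n.
  by move=> [Q [hQ cQ nQ]]; exists Q; split=> //; exact: sub.
have [Nn _] := minN _ Nphi.
have [_] := minN psi (ex_intro _ _ (Npsi _ Nn)).
by apply; exact: Npsi.
Qed.

Section Main.
Variables (C : set (set V)) (f g h : Fbar).
Hypothesis hC : polyhedral_complex C.
Hypothesis cg : convex_cls C g.
Hypothesis ch : convex_cls C h.
Hypothesis fgh : f = g - h.
Hypothesis fg : supp_pos C f = supp C g.
Hypothesis fh : supp_neg C f = supp C h.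

Lemma weights_disjoint S : walls C S ->
  weight C (rep g) S = 0 \/ weight C (rep h) S = 0.
Proof.
move=> wS; have [g0|g0] := eqVneq (weight C (rep g) S) 0; first by left.
right; apply/eqP/negPn/negP => h0.
have [_ f1] : supp_pos C f S by rewrite fg.
have [_ f2] : supp_neg C f S by rewrite fh.
by have := lt_trans f1 f2; rewrite ltxx.
Qed.

Lemma locally_affine_summand z : (forall F, C F -> thin F -> ~ F z) ->
  locally_affine (rep g) z \/ locally_affine (rep h) z.
Proof.
apply: locally_affine_off_thin => //; last exact: weights_disjoint.
  by have [] := (convex_clsP _ _).1 cg.
by have [] := (convex_clsP _ _).1 ch.
Qed.

(** For [g] this is [compatible_difference]; then [h] is the difference of two
    compatible functions. *)
Lemma summands_compatible Q : polyhedral_complex Q -> compatible Q (rep f) ->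
  compatible Q (rep g) /\ compatible Q (rep h).
Proof.
move=> hQ cf; have [cG kG] := (convex_clsP _ _).1 cg.
have cGH : compatible Q (rep g - rep h).
  by apply: compatible_cls_eq cf; rewrite clsB !repK.
have cQ : compatible Q (rep g).
  exact: (compatible_difference hC cG kG locally_affine_summand hQ cGH).
split=> //; apply: compatible_cls_eq (compatibleB cQ cf).
by rewrite clsB !repK fgh opprB addrC subrK.
Qed.

(** For a decomposition [(g', h')] the class [v] is [g' - g], which equals
    [h' - h] and is convex by [convex_difference]; it is compatible with [Q]
    because [g] is. *)
Lemma decompositionP Q (u : Fbar * Fbar) :
  polyhedral_complex Q -> compatible_cls Q f ->
  decompositions Q f u <-> exists2 v : Fbar, convex_cls Q v & u = (g + v, h + v).
Proof.
move=> hQ /compatible_clsP cf; have [cG kG] := (convex_clsP _ _).1 cg.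
have [cH kH] := (convex_clsP _ _).1 ch.
have [cQg cQh] := summands_compatible hQ cf.
have Qg : convex_cls Q g by apply/convex_clsP.
have Qh : convex_cls Q h by apply/convex_clsP.
split=> [|[v cv ->]]; last first.
  by split=> /=; [exact: convex_clsD..|rewrite fgh opprD addrACA subrr addr0].
case: u => g' h' [/= /convex_clsP[cg' kg'] /convex_clsP[ch' kh'] fE].
have gh : g' - g = h' - h.
  by apply/eqP; rewrite subr_eq -addrA [- h + g]addrC -fgh fE addrC subrK.
exists (g' - g); last by rewrite {2}gh !(addrC _ (_ - _)) !subrK.
rewrite -(repK g') -(repK g) -clsB; apply: convex_cls_intro; first exact: compatibleB.
apply: (convex_difference hC cG locally_affine_summand kg' kh').
  exact: compatible_ray_affine hQ cg'.
by apply/is_affine_cls; rewrite 3!clsB !repK gh subrr.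
Qed.

(** By [decompositionP] the question is about the diagonal cone of convex classes.
    Its apex is a vertex because minus the sum of finitely many gaps is a linear
    form that is negative on all its nonzero elements.  It is the only one because
    any element [(v, v)] is the midpoint of the apex and [(v + v, v + v)]. *)
Lemma unique_vertex Q : polyhedral_complex Q -> compatible_cls Q f ->
  vertices (decompositions Q f) = [set (g, h)].
Proof.
move=> hQ cf; have DP (u : Fbar * Fbar) := decompositionP u hQ cf.
have c0 : convex_cls Q 0.
  rewrite -cls0; apply: convex_cls_intro => [P _|].
    by exists 0, 0 => x _; rewrite dot0l addr0.
  by apply/convex_funP => x y r _; rewrite [leLHS]/= subrr mulr0 addr0.
have Dgh : decompositions Q f (g, h) by apply/DP; exists 0 => //; rewrite !addr0.
have [s [s01 sP]] := gaps_detect_affine hQ.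
pose l (u : Fbar * Fbar) : R := - \sum_(i <- s) gap (rep u.1) i.
have lin : linear_for *%R l.
  move=> k u v; rewrite /l mulrN mulr_sumr -opprD -big_split; congr (- _).
  by apply: eq_bigr => i _; exact: gap_cls_comb.
pose lm := GRing.isLinear.Build R (Fbar * Fbar)%type R *%R l lin.
pose L : {scalar (Fbar * Fbar)%type} := HB.pack l lm.
have LE (u : Fbar * Fbar) : L u = l u by [].
have gap0 v i : convex_cls Q v -> i \in s -> 0 <= gap (rep v) i.
  by move=> /convex_clsP[_ kv] /s01; exact: gap_ge0.
have lD v : l (g + v, h + v) = l (g, h) - \sum_(i <- s) gap (rep v) i.
  rewrite /l -opprD -big_split; congr (- _).
  by apply: eq_bigr => i _; exact: gap_clsD.
have zero (v : Fbar) : convex_cls Q v ->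
    \sum_(i <- s) gap (rep v) i = 0 -> v = 0.
  move=> cv /eqP; rewrite big_seq_cond psumr_eq0 => [/allP s0|i]; last first.
    by rewrite andbT => /(gap0 _ _ cv).
  rewrite -(repK v); apply/is_affine_cls; have [cc kc] := (convex_clsP _ _).1 cv.
  by apply: sP => // i iS; have := s0 i iS; rewrite andbT iS => /eqP.
apply/seteqP; split=> [z [L' [b [Lb zE]]]|_ ->].
  have [zD zb] : (decompositions Q f `&` [set x | L' x = b]) z by rewrite -zE.
  have /DP[v cv zv] := zD.
  have Dw : decompositions Q f (g + (v + v), h + (v + v)).
    by apply/DP; exists (v + v) => //; exact: convex_clsD.
  have e : (g, h) + (g + (v + v), h + (v + v)) = z + z.
    by rewrite zv; congr pair; rewrite /= [RHS]addrACA -addrA.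
  have gb : L' (g, h) = b.
    have := Lb _ Dgh; have := Lb _ Dw; have := congr1 L' e.
    rewrite !linearD; move: zb => /= ->; lra.
  have : [set z] (g, h) by rewrite zE.
  by move=> /= ->.
exists L, (l (g, h)); split=> [u /DP[v cv ->]|].
  rewrite LE lD gerBl big_seq_cond sumr_ge0// => i.
  by rewrite andbT => /(gap0 _ _ cv).
apply/seteqP; split=> [_ ->|u [/DP[v cv ->] uL]] //.
have : l (g + v, h + v) = l (g, h) := uL.
rewrite lD => /eqP; rewrite -subr_eq0 addrAC subrr add0r oppr_eq0.
move=> /eqP/(zero _ cv) ->.
by rewrite !addr0.
Qed.

End Main.
End Classes.

(** * The unique vertex and the number of pieces *)

Unset Implicit Arguments.
Set Strict Implicit.

Theorem proposition4p16 (R : realType) (d : nat) (C : set (set 'rV[R]_d))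
    (f g h : modAff R d) :
  polyhedral_complex C ->
  compatible_cls C f ->
  convex_cls C g ->
  convex_cls C h ->
  f = g - h ->
  supp_pos C f = supp C g ->
  supp_neg C f = supp C h ->
  (forall Q : set (set 'rV[R]_d),
     polyhedral_complex Q -> regular Q -> compatible_cls Q f ->
     vertices (decompositions Q f) = [set (g, h)]) /\
  (num_pieces_cls g <= num_pieces_cls f)%N /\
  (num_pieces_cls h <= num_pieces_cls f)%N.
Proof.
move=> hC cf cg ch fgh fg fh.
have sub Q := @summands_compatible _ _ C f g h hC cg ch fgh fg fh Q.
split=> [Q hQ _|]; first exact: (@unique_vertex _ _ C f g h hC cg ch fgh fg fh).
have ex : exists2 C, polyhedral_complex C & compatible C (rep f).
  by exists C => //; exact/compatible_clsP.
by split; apply: num_pieces_le => // Q hQ /(sub Q hQ)[].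
Qed.
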